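(* Let $q\in S^1$ and $m\in\mathbb{Z}$. Then the set $PL_m^q(S^1,S^1)$ is dense in $C_m^q(S^1,S^1)$ with respect to the metric $d_0$.
   Context: $S^1=\{(x,y)\in\mathbb{R}^2: x^2+y^2=1\}$, $I=[0,1]$, and $C(S^1,S^1)$ is the set of all continuous functions from $S^1$ to $S^1$. Let $\alpha:[0,1]\to S^1$, $\alpha(t)=(\cos 2\pi t,\sin 2\pi t)$, and let $p:\mathbb{R}\to S^1$, $p(t)=(\cos 2\pi t,\sin 2\pi t)$, be the covering map. For $f\in C(S^1,S^1)$, let $\tilde{f_\alpha}:I\to\mathbb{R}$ be the unique continuous map with $p\circ\tilde{f_\alpha}=f\circ\alpha$ and $\tilde{f_\alpha}(0)\in[0,1)$. For $x\in S^1$, $x\neq(1,0)$, $\alpha^{-1}(x)$ denotes the unique $t\in(0,1)$ with $\alpha(t)=x$. The metric $d_0$ on $C(S^1,S^1)$ is $$d_0(f,g)=2\pi\sup_{x\in S^1,\ x\neq(1,0)}\left|\tilde{f_\alpha}(\alpha^{-1}(x))-\tilde{g_\alpha}(\alpha^{-1}(x))\right|.$$ The winding number of $f\in C(S^1,S^1)$ is the integer $W(f)=\tilde{f_\alpha}(1)-\tilde{f_\alpha}(0)$. A function $h:[a,b]\to\mathbb{R}$ is piecewise linear (PL) if there are points $a=p_1<p_2<\dots<p_k=b$ and reals $q_1,\dots,q_k$ such that for every $1\le i\le k-1$ and all $t\in[p_i,p_{i+1}]$, $h(t)=q_i+(q_{i+1}-q_i)\frac{t-p_i}{p_{i+1}-p_i}$.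 For $a,b\in\mathbb{R}$, $PL_{a,b}(I,\mathbb{R})$ is the set of PL functions $h:I\to\mathbb{R}$ with $h(0)=a$ and $h(1)=b$. For $q\in S^1$, let $\tilde q$ be the unique element of $[0,1)$ with $p(\tilde q)=q$. For $q\in S^1$ and $m\in\mathbb{Z}$, $$C_m^q(S^1,S^1)=\{f\in C(S^1,S^1): f((1,0))=q,\ W(f)=m\},$$ $$PL_m^q(S^1,S^1)=\{f\in C(S^1,S^1): \tilde{f_\alpha}\in PL_{\tilde q,\tilde q+m}(I,\mathbb{R}),\ p\circ\tilde{f_\alpha}(0)=q\}.$$ *)

(* Defs.v *)
From HB Require Import structures.
From mathcomp Require Import all_boot all_order all_algebra.
From mathcomp Require Import all_classical all_reals all_analysis.

Set Implicit Arguments.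
Unset Strict Implicit.
Unset Printing Implicit Defensive.

Import Order.TTheory GRing.Theory Num.Theory.
Import numFieldNormedType.Exports.

Local Open Scope classical_set_scope.
Local Open Scope ring_scope.

Section CircleMaps.
Variable R : realType.

Definition circle : set (R * R) := [set v | v.1 ^+ 2 + v.2 ^+ 2 = 1].

(* The type of points of [circle], with the topology induced by R * R. *)
Definition S1 : topologicalType := set_type circle.

Lemma basepoint_circle : circle (1, 0).
Proof. by rewrite /circle /= expr1n expr0n addr0. Qed.

Definition basepoint : S1 := SigSub (mem_set basepoint_circle).

Lemma cos_sin_circle (x : R) : circle (cos x, sin x).
Proof. by rewrite /circle /= cos2Dsin2. Qed.

(* The loop alpha is the restriction of [covering_map] to [0, 1]. *)
Definition covering_map (t : R) : S1 :=
  SigSub (mem_set (cos_sin_circle (2 * pi * t))).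

(* A map I -> R is represented by a function on R of which only the values
   on I = [0, 1] are meaningful. *)
Definition is_lift (f : S1 -> S1) (h : R -> R) : Prop :=
  [/\ {within `[0, 1], continuous h},
      {in `[0, 1], forall t, covering_map (h t) = f (covering_map t)} &
      0 <= h 0 < 1].

(* For continuous f a lift exists and is unique on [0, 1], so the default value
   of [xget] is irrelevant; likewise for [tilde], and for [alpha_inv], which is
   only used away from [basepoint]. *)
Definition alpha_lift (f : S1 -> S1) : R -> R := xget (fun=> 0) (is_lift f).

Definition alpha_inv (x : S1) : R :=
  xget 0 [set t | 0 < t < 1 /\ covering_map t = x].

Definition d0 (f g : continuousType S1 S1) : R :=
  2 * pi *
  sup [set `|alpha_lift f (alpha_inv x) - alpha_lift g (alpha_inv x)|
      | x in [set x | x <> basepoint]].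

Definition winding (f : continuousType S1 S1) : R :=
  alpha_lift f 1 - alpha_lift f 0.

(* The breakpoints are s 0 < ... < s n, with prescribed values v 0, ..., v n. *)
Definition piecewise_linear (a b : R) (h : R -> R) : Prop :=
  exists (n : nat) (s v : nat -> R),
    [/\ s 0%N = a, s n = b,
        forall i, (i < n)%N -> s i < s i.+1 &
        forall i t, (i < n)%N -> s i <= t <= s i.+1 ->
          h t = v i + (v i.+1 - v i) * ((t - s i) / (s i.+1 - s i))].

Definition PL (a b : R) : set (R -> R) :=
  [set h | [/\ piecewise_linear 0 1 h, h 0 = a & h 1 = b]].

Definition tilde (q : S1) : R :=
  xget 0 [set t | 0 <= t < 1 /\ covering_map t = q].

Definition C_S1 (q : S1) (m : int) : set (continuousType S1 S1) :=
  [set f : continuousType S1 S1 | f basepoint = q /\ winding f = m%:~R].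

Definition PL_S1 (q : S1) (m : int) : set (continuousType S1 S1) :=
  [set f : continuousType S1 S1 |
    PL (tilde q) (tilde q + m%:~R) (alpha_lift f) /\ covering_map (alpha_lift f 0) = q].

End CircleMaps.

Definition dense_in (R : realType) (T : Type) (d : T -> T -> R)
    (A B : set T) : Prop :=
  A `<=` B /\
  forall f, B f -> forall e : R, 0 < e -> exists2 g, A g & d f g < e.

(* Main.v *)
Require Import Defs.
From HB Require Import structures.
From mathcomp Require Import all_boot all_order all_algebra.
From mathcomp Require Import all_classical all_reals all_analysis.
From mathcomp Require Import ring lra.

Set Implicit Arguments.
Unset Strict Implicit.
Unset Printing Implicit Defensive.

Import Order.TTheory GRing.Theory Num.Theory.
Import numFieldNormedType.Exports.

Local Open Scope classical_set_scope.
Local Open Scope ring_scope.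

(* Lift f to h : I -> R and interpolate h linearly on a fine uniform
   subdivision. The interpolation w has the same values as h at 0 and 1, so
   covering_map \o w is a loop and descends to a continuous g : S1 -> S1. By
   uniqueness of lifts w is the lift of g, so d0 f g is at most 2 pi times the
   uniform distance from h to w. *)

(** * The covering map of the circle *)

Lemma covering_map_eqP (R : realType) (a b : R) :
  covering_map a = covering_map b <->
  cos (2 * pi * a) = cos (2 * pi * b) /\ sin (2 * pi * a) = sin (2 * pi * b).
Proof.
split=> [ab|[cab sab]].
  by have /pair_equal_spec := congr1 val ab.
by apply: val_inj; rewrite /= cab sab.
Qed.

(** For [0 < y < 1], [sin (pi * y)] is positive, so the double angle formula keeps
    [cos (2 * pi * y)] below 1; negative arguments follow by parity. *)
Lemma cos_eq1_small (R : realType) (x : R) :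
  `|x| < 1 -> cos (2 * pi * x) = 1 -> x = 0.
Proof.
have pos (y : R) : 0 < y -> y < 1 -> cos (2 * pi * y) != 1.
  move=> y0 y1; have spy : 0 < sin (pi * y).
    by apply: sin_gt0_pi; rewrite mulr_gt0 ?pi_gt0//= gtr_pMr ?pi_gt0.
  apply/eqP => c1; have := cos_mulr2n (pi * y).
  have := cos2Dsin2 (pi * y).
  have -> : (pi * y) *+ 2 = 2 * pi * y by rewrite mulr_natl mulrnAl.
  by rewrite c1; nra.
move=> x1 c1; apply: contrapT => /eqP; rewrite neq_lt => /orP[x0|x0].
  have : cos (2 * pi * (- x)) != 1.
    by apply: pos; [rewrite oppr_gt0|rewrite -(ltr0_norm x0)].
  by rewrite mulrN cosN c1 eqxx.
have : cos (2 * pi * x) != 1 by apply: pos => //; rewrite -(gtr0_norm x0).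
by rewrite c1 eqxx.
Qed.

Lemma covering_map_inj_small (R : realType) (a b : R) :
  covering_map a = covering_map b -> `|a - b| < 1 -> a = b.
Proof.
move=> /covering_map_eqP[cab sab] ab; apply/subr0_eq/cos_eq1_small => //.
by rewrite mulrBr cosB cab sab -!expr2 cos2Dsin2.
Qed.

Lemma covering_map01 (R : realType) : covering_map (0 : R) = covering_map 1.
Proof.
by apply/covering_map_eqP; rewrite mulr0 mulr1 mulr_natl cos2pi sin2pi cos0 sin0.
Qed.

Lemma covering_map0 (R : realType) : covering_map (0 : R) = basepoint R.
Proof. by apply: val_inj; rewrite /= mulr0 cos0 sin0. Qed.

Lemma S1_sqrD (R : realType) (x : S1 R) : (val x).1 ^+ 2 + (val x).2 ^+ 2 = 1.
Proof. exact: set_mem (valP x). Qed.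

Lemma covering_map_surj (R : realType) (x : S1 R) :
  exists2 t, 0 <= t < 1 & covering_map t = x.
Proof.
have := S1_sqrD x; set a := (val x).1; set b := (val x).2 => ab.
have a1 : -1 <= a <= 1 by apply/andP; split; nra.
have cosa : cos (acos a) = a by apply: acosK; rewrite in_itv.
have sina : sin (acos a) = `|b|.
  by rewrite sin_acos// -sqrtr_sqr; congr Num.sqrt; rewrite -ab; ring.
have pi0 := pi_gt0 R.
have a0 := acos_ge0 a1; have api := acos_lepi a1.
pose t := acos a / (2 * pi).
have tE : 2 * pi * t = acos a by rewrite /t mulrC divfK// gt_eqF ?mulr_gt0.
have xE : val x = (a, b) by rewrite /a /b; case: (val x).
have [b0|b0] := leP 0 b.
  exists t; first by apply/andP; split; nra.
  by apply: val_inj; rewrite /= tE cosa sina ger0_norm.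
(* On the lower half circle the angle is [2 * pi - acos a]; [b < 0] forces [a < 1], hence
   [acos a > 0] and [1 - t < 1]. *)
exists (1 - t).
  have : 0 < acos a by apply: acos_gt0; apply/andP; split; nra.
  by move=> ?; apply/andP; split; nra.
apply: val_inj; rewrite /= mulrBr mulr1 tE mulr_natl cosB sinB cos2pi sin2pi.
rewrite cosa sina ltr0_norm// xE; congr pair; ring.
Qed.

Lemma continuous_covering_map (R : realType) : continuous (@covering_map R).
Proof.
apply: (@continuous_comp_initial _ _ _ (val : S1 R -> R * R)) => x.
have cl : {for x, continuous (fun t : R => 2 * pi * t)}.
  by apply: cvgM; [exact: cvg_cst|exact: cvg_id].
apply: (@cvg_pair _ _ _ _ (nbhs (cos (2 * pi * x))) (nbhs (sin (2 * pi * x)))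
  _ _ _ (fun t => cos (2 * pi * t)) (fun t => sin (2 * pi * t))).
- by apply: (continuous_comp cl); exact: continuous_cos.
- by apply: (continuous_comp cl); exact: continuous_sin.
Qed.

(** * Uniform continuity on a segment *)

(** Heine's theorem: compactness, in its near-covering form, makes the local choices of [d] near
    [0^'+] uniform. *)
Lemma segment_unif_continuous (R : realType) (a b : R) (f : R -> R) :
  {within `[a, b], continuous f} -> forall e, 0 < e ->
  exists2 d, 0 < d & forall s t, s \in `[a, b] -> t \in `[a, b] ->
    `|s - t| < d -> `|f s - f t| < e.
Proof.
move=> /subspace_continuousP cf e e0.
have := @segment_compact R a b.
move=> /compact_near_coveringP/near_covering_withinP => /(_ R (0^'+)
  (fun d s => forall t, t \in `[a, b] -> `|s - t| < d -> `|f s - f t| < e)).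
have FF : Filter (0 : R)^'+ by exact: at_right_proper_filter.
move=> /(_ FF) near_d.
suff /near_d : forall x : R, `[a, b]%classic x ->
    \forall x' \near x & d \near 0^'+, `[a, b]%classic x' ->
    forall t, t \in `[a, b] -> `|x' - t| < d -> `|f x' - f t| < e.
  move=> hd; have /filter_ex : \forall d \near (0 : R)^'+, 0 < d /\
      (`[a, b]%classic `<=` (fun s => forall t, t \in `[a, b] ->
        `|s - t| < d -> `|f s - f t| < e)).
    apply: filterI => //; exact: nbhs_right_gt.
  by move=> [d [d0 hd']]; exists d => // s t sab; exact: hd'.
move=> x xab; have /cvgrPdist_lt /(_ (e / 2)) := cf _ xab.
rewrite divr_gt0// => /(_ isT); rewrite near_withinE.
move=> /nbhs_ballP[r /= r0 xr].
have r2 : 0 < r / 2 by rewrite divr_gt0.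
(* With these radii both [y] and any [t] closer than [d] to [y] lie within [r] of [x]. *)
exists (ball x (r / 2), [set d | d < r / 2]).
  by split; [exact: nbhsx_ballx|exact: nbhs_right_lt].
move=> [y d] [/= xy dr] yab t tab yt.
have fxy : `|f x - f y| < e / 2.
  by apply: xr => //; apply: lt_le_trans xy _; lra.
have fxt : `|f x - f t| < e / 2.
  apply: xr; last by [].
  have -> : r = r / 2 + r / 2 by lra.
  rewrite /ball/= -[x - t](subrKA y); apply: le_lt_trans (ler_normD _ _) _.
  by rewrite ltrD// (lt_trans yt).
have -> : f y - f t = (f x - f t) - (f x - f y) by ring.
have -> : e = e / 2 + e / 2 by lra.
by apply: le_lt_trans (ler_normB _ _) _; rewrite ltrD.
Qed.

(** The eventual form lets several functions share one mesh, by intersecting filter sets. *)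
Lemma segment_unif_mesh (R : realType) (f : R -> R) :
  {within `[0, 1], continuous f} -> forall e, 0 < e ->
  \forall n \near \oo, forall s t, s \in `[0, 1] -> t \in `[0, 1] ->
    `|s - t| <= n.+1%:R^-1 -> `|f s - f t| < e.
Proof.
move=> /segment_unif_continuous + e e0 => /(_ e e0)[d d0 fd].
near=> n => s t s01 t01 st; apply: fd => //; apply: le_lt_trans st _.
near: n; exact: near_infty_natSinv_lt (PosNum d0).
Unshelve. all: by end_near. Qed.

(** * Existence and uniqueness of lifts *)

Lemma dot_cross_circle (R : comNzRingType) (p1 p2 q1 q2 : R) :
  p1 ^+ 2 + p2 ^+ 2 = 1 -> q1 ^+ 2 + q2 ^+ 2 = 1 ->
  (p1 * q1 + p2 * q2) ^+ 2 + (p1 * q2 - p2 * q1) ^+ 2 = 1.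
Proof.
move=> p q; transitivity ((p1 ^+ 2 + p2 ^+ 2) * (q1 ^+ 2 + q2 ^+ 2)); last first.
  by rewrite p q mulr1.
ring.
Qed.

(** [th] is the signed angle from the unit vector of angle [phi] to [(q1, q2)]: its sine is their
    cross product, and since their dot product is positive, it is the cosine of [th]. *)
Lemma cos_sin_add_asin (R : realType) (phi q1 q2 : R) :
  q1 ^+ 2 + q2 ^+ 2 = 1 -> 0 < cos phi * q1 + sin phi * q2 ->
  let th := asin (cos phi * q2 - sin phi * q1) in
  cos (phi + th) = q1 /\ sin (phi + th) = q2.
Proof.
move=> q_circle dot_gt0 /=; have p_circle := cos2Dsin2 phi.
set p1 := cos phi in p_circle dot_gt0 *; set p2 := sin phi in p_circle dot_gt0 *.
have lagrange := dot_cross_circle p_circle q_circle.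
have cross1 : -1 <= p1 * q2 - p2 * q1 <= 1 by apply/andP; split; nra.
rewrite cosD sinD -/p1 -/p2 cos_asin// asinK ?in_itv//.
have -> : 1 - (p1 * q2 - p2 * q1) ^+ 2 = (p1 * q1 + p2 * q2) ^+ 2.
  by rewrite -lagrange addrK.
rewrite sqrtr_sqr gtr0_norm//; split.
- by rewrite -[RHS]mul1r -p_circle; ring.
- by rewrite -[RHS]mul1r -p_circle; ring.
Qed.

(** The squared distance of two unit vectors is 2 minus twice their dot product, and here it is
    below 2. *)
Lemma dot_gt0_close (R : realFieldType) (p1 p2 q1 q2 : R) :
  p1 ^+ 2 + p2 ^+ 2 = 1 -> q1 ^+ 2 + q2 ^+ 2 = 1 ->
  `|p1 - q1| < 1 -> `|p2 - q2| < 1 -> 0 < p1 * q1 + p2 * q2.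
Proof.
rewrite !ltr_norml => p q /andP[l1 r1] /andP[l2 r2].
have : (p1 - q1) ^+ 2 < 1 by nra.
have : (p2 - q2) ^+ 2 < 1 by nra.
by nra.
Qed.

(* With the mesh fine enough, the angle from f(alpha(i t / n)) to
   f(alpha((i + 1) t / n)) is the arcsine of a continuous function of t; the
   lift at t is the initial angle plus the sum of these n angles. *)
Lemma lift_exists (R : realType) (f : S1 R -> S1 R) :
  continuous f -> exists h, is_lift f h.
Proof.
move=> cf.
pose u1 t := (val (f (covering_map t))).1.
pose u2 t := (val (f (covering_map t))).2.
have cval : continuous (fun t : R => val (f (covering_map t))).
  move=> t; apply: (@continuous_comp _ _ _ (f \o @covering_map R)).
    by apply: continuous_comp; [exact: continuous_covering_map|exact: cf].
  exact: initial_continuous.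
have cu1 : continuous u1.
  by move=> t; apply: (continuous_comp (cval t)); exact: cvg_fst.
have cu2 : continuous u2.
  by move=> t; apply: (continuous_comp (cval t)); exact: cvg_snd.
have u_circle t : u1 t ^+ 2 + u2 t ^+ 2 = 1 by exact: S1_sqrD.
have [n [n1 n2]] : exists n, (forall s t : R, s \in `[0, 1] -> t \in `[0, 1] ->
      `|s - t| <= n.+1%:R^-1 -> `|u1 s - u1 t| < 1) /\
    (forall s t : R, s \in `[0, 1] -> t \in `[0, 1] ->
      `|s - t| <= n.+1%:R^-1 -> `|u2 s - u2 t| < 1).
  apply: (@filter_ex _ \oo); apply: filterI.
  - by apply: segment_unif_mesh => //; exact: continuous_subspaceT.
  - by apply: segment_unif_mesh => //; exact: continuous_subspaceT.
pose c i : R := i%:R / n.+1%:R.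
have cM i t : (i <= n.+1)%N -> t \in `[0, 1] -> c i * t \in `[0, 1].
  rewrite !in_itv/= => iN /andP[t0 t1]; have ci0 : 0 <= c i by rewrite divr_ge0.
  have ci1 : c i <= 1 by rewrite ler_pdivrMr ?mul1r ?ler_nat.
  by rewrite mulr_ge0//= mulr_ile1.
have dot_gt0 (i : nat) t : (i < n.+1)%N -> t \in `[0, 1] ->
    0 < u1 (c i * t) * u1 (c i.+1 * t) + u2 (c i * t) * u2 (c i.+1 * t).
  move=> iN t01; have ctE : `|c i * t - c i.+1 * t| <= n.+1%:R^-1.
    have -> : c i * t - c i.+1 * t = - (n.+1%:R^-1 * t).
      by rewrite /c -(@natr1 _ i); ring.
    move: t01; rewrite in_itv/= => /andP[t0 t1].
    by rewrite normrN ger0_norm ?ler_piMr// mulr_ge0.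
  by apply: dot_gt0_close => //; [apply: n1|apply: n2] => //; apply: cM => //; exact: ltnW.
pose cross i t := u1 (c i * t) * u2 (c i.+1 * t) - u2 (c i * t) * u1 (c i.+1 * t).
have [t0 t01 t0E] := covering_map_surj (f (covering_map 0)).
pose h k t := t0 + (\sum_(i < k) asin (cross i t)) / (2 * pi).
have pi2 : 2 * pi != 0 :> R by rewrite mulf_neq0// gt_eqF ?pi_gt0.
(* The partial sum of the first [k] angles lifts the path up to [c k * t]; the case [k = n.+1],
   where [c k = 1], gives the lift. *)
have hE k t : (k <= n.+1)%N -> t \in `[0, 1] ->
    covering_map (h k t) = f (covering_map (c k * t)).
  elim: k => [|k IHk] kn t01'; first by rewrite /h /c big_ord0 !mul0r addr0.
  have E := IHk (ltnW kn) t01'.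
  have e1 : u1 (c k * t) = cos (2 * pi * h k t) by rewrite /u1 -E.
  have e2 : u2 (c k * t) = sin (2 * pi * h k t) by rewrite /u2 -E.
  have := dot_gt0 k t kn t01'; rewrite e1 e2 => dot.
  have [] := cos_sin_add_asin (u_circle (c k.+1 * t)) dot.
  have -> : 2 * pi * h k t + asin (cos (2 * pi * h k t) * u2 (c k.+1 * t) -
      sin (2 * pi * h k t) * u1 (c k.+1 * t)) = 2 * pi * h k.+1 t.
    rewrite -e1 -e2 -/(cross k t) /h big_ord_recr/=.
    by move: (2 * pi) pi2 => P P0; field.
  by move=> cE sE; apply: val_inj; rewrite /= cE sE /u1 /u2 -surjective_pairing.
exists (h n.+1); split.
- apply: continuous_in_subspaceT => t /set_mem t01'.
  apply: cvgD; first exact: cvg_cst.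
  apply: cvgM; last exact: cvg_cst.
  apply: cvg_big => [|i _].
    exact: add_continuous.
  have cu (u : R -> R) (a : R) : continuous u ->
      {for t, continuous (fun s : R => u (a * s))}.
    move=> uc; apply: (@continuous_comp _ _ _ (fun s : R => a * s) u).
      by apply: cvgM; [exact: cvg_cst|exact: cvg_id].
    exact: uc.
  apply: (@continuous_comp _ _ _ (cross i) (@asin R)).
    by apply: cvgB; apply: cvgM; exact: cu.
  (* [asin] is continuous on the open interval only; the positive dot product keeps the cross
     product strictly between -1 and 1. *)
  apply: continuous_asin.
  have := dot_gt0 i t (ltn_ord i) t01'.
  have := dot_cross_circle (u_circle (c i * t)) (u_circle (c i.+1 * t)).
  rewrite -/(cross i t); move: (cross i t) (u1 _ * u1 _ + _) => x y ? ?.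
  by apply/andP; split; nra.
- move=> t t01'; rewrite hE// /c divff ?mul1r// ?pnatr_eq0//.
(* At [t = 0] all points [c i * t] coincide, so every angle is [asin 0]. *)
- suff -> : h n.+1 0 = t0 by [].
  rewrite /h big1 ?mul0r ?addr0// => i _.
  rewrite /cross !mulr0 mulrC subrr.
  have : (0 : R) \in `[- (pi / 2), pi / 2].
    by rewrite in_itv/=; have := pi_gt0 R; move=> ?; apply/andP; split; lra.
  by move=> /sinK; rewrite sin0.
Qed.

Lemma lift_unique (R : realType) (f : S1 R -> S1 R) (h1 h2 : R -> R) :
  is_lift f h1 -> is_lift f h2 -> {in `[0, 1], h1 =1 h2}.
Proof.
(* A nonzero integer value of h1 - h2 would force the value 1/2 or -1/2, by
   the intermediate value theorem. *)
move=> [c1 f1 i1] [c2 f2 i2] t t01.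
have zero01 : (0 : R) \in `[0, 1] by rewrite in_itv/= lexx ler01.
have cosd s : s \in `[0, 1] -> cos (2 * pi * (h1 s - h2 s)) = 1.
  move=> s01; have /covering_map_eqP[cE sE] : covering_map (h1 s) = covering_map (h2 s).
    by rewrite f1// f2.
  by rewrite mulrBr cosB cE sE -!expr2 cos2Dsin2.
(* Both initial values lie in [[0, 1)], so their difference is below 1 in absolute value. *)
have d0 : h1 0 - h2 0 = 0.
  by apply: cos_eq1_small (cosd _ zero01); rewrite ltr_norml; apply/andP; split; lra.
have t0 : 0 <= t by move: t01; rewrite in_itv/= => /andP[].
have ct : {within `[0, t], continuous (h1 - h2)}.
  have sub : `[0, t] `<=` `[0, 1].
    move=> s /=; rewrite !in_itv/= => /andP[-> st]/=; apply: le_trans st _.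
    by move: t01; rewrite in_itv/= => /andP[].
  apply: (continuous_subspaceW sub) => x; exact: cvgB (c1 x) (c2 x).
have half (v : R) : cos (2 * pi * v) != 1 -> Num.min 0 (h1 t - h2 t) <= v <=
    Num.max 0 (h1 t - h2 t) -> False.
  move=> /eqP cv vE; have [|s s0t sE] := IVT t0 ct (v := v).
    by rewrite /GRing.add/= /GRing.opp/= d0.
  apply: cv; rewrite -sE cosd//.
  move: s0t t01; rewrite !in_itv/= => /andP[-> st] /andP[_ t1].
  exact: le_trans st t1.
apply/subr0_eq/cos_eq1_small; last exact: cosd.
have chalf : cos (2 * pi * 2^-1) != 1 :> R.
  by rewrite mulrAC divff// mul1r cospi; apply/eqP; lra.
rewrite ltr_norml; apply: contrapT => /negP; rewrite negb_and -!leNgt.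
case/orP => dt.
- apply: (half (- 2^-1)); first by rewrite mulrN cosN.
  by rewrite ge_min le_max; apply/andP; split; apply/orP; [right|left]; lra.
- apply: (half 2^-1) => //.
  by rewrite ge_min le_max; apply/andP; split; apply/orP; [left|right]; lra.
Qed.

(** * Piecewise linear interpolation *)

Definition clamp (R : realType) (x : R) : R := Num.max 0 (Num.min 1 x).

Lemma continuous_clamp (R : realType) : continuous (@clamp R).
Proof.
move=> x; apply: (@continuous_max R R (cst 0) (fun x => Num.min 1 x)).
  exact: cvg_cst.
by apply: (@continuous_min R R (cst 1) id); [exact: cvg_cst|exact: cvg_id].
Qed.

(* The PL function with vertices (i / n, v i); as a sum of ramps it is
   continuous on the whole line without any gluing. *)
Definition interpolation (R : realType) (n : nat) (v : nat -> R) (t : R) : R :=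
  v 0%N + \sum_(i < n) (v i.+1 - v i) * clamp (n%:R * t - i%:R).

Lemma continuous_interpolation (R : realType) n (v : nat -> R) :
  continuous (interpolation n v).
Proof.
move=> t; apply: cvgD; first exact: cvg_cst.
apply: cvg_big => [|i _]; first exact: add_continuous.
apply: cvgM; first exact: cvg_cst.
apply: (@continuous_comp _ _ _ (fun t : R => n%:R * t - i%:R)).
  by apply: cvgB; [apply: cvgM; [exact: cvg_cst|exact: cvg_id]|exact: cvg_cst].
exact: continuous_clamp.
Qed.

Lemma clamp_ge1 (R : realType) (x : R) : 1 <= x -> clamp x = 1.
Proof. by move=> x1; rewrite /clamp min_l// max_r. Qed.

Lemma clamp_le0 (R : realType) (x : R) : x <= 0 -> clamp x = 0.
Proof. by move=> x0; rewrite /clamp max_l// ge_min x0 orbT. Qed.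

Lemma clamp_id (R : realType) (x : R) : 0 <= x <= 1 -> clamp x = x.
Proof. by move=> /andP[x0 x1]; rewrite /clamp min_r// max_r. Qed.

(** On cell [k] the earlier ramps are saturated at 1 and telescope to [v k - v 0], the later ones
    are still 0, and only ramp [k] varies. *)
Lemma interpolation_segment (R : realType) n (v : nat -> R) k t :
  (k < n)%N -> k%:R <= n%:R * t <= k.+1%:R ->
  interpolation n v t = v k + (v k.+1 - v k) * (n%:R * t - k%:R).
Proof.
move=> kn /andP[kt tk]; rewrite /interpolation.
rewrite -(big_mkord xpredT (fun i => (v i.+1 - v i) * clamp (n%:R * t - i%:R))).
rewrite (big_cat_nat (n := k.+1))//= big_nat_recr//=.
have -> : \sum_(k.+1 <= i < n) (v i.+1 - v i) * clamp (n%:R * t - i%:R) = 0.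
  rewrite big_nat big1// => i /andP[ki _].
  by rewrite clamp_le0 ?mulr0// subr_le0 (le_trans tk)// ler_nat.
rewrite addr0 clamp_id; last first.
  by rewrite -natr1 in tk; apply/andP; split; lra.
rewrite addrA; congr (_ + _).
rewrite (eq_big_nat _ _ (F2 := fun i => v i.+1 - v i)).
  by rewrite telescope_sumr// addrC subrK.
move=> i /andP[_ ik]; rewrite clamp_ge1 ?mulr1// lerBrDr.
by apply: le_trans kt; rewrite nat1r ler_nat.
Qed.

Lemma exists_mesh_cell (R : realType) n (t : R) : (0 < n)%N -> 0 <= t <= 1 ->
  exists2 k, (k < n)%N & k%:R <= n%:R * t <= k.+1%:R.
Proof.
move=> n0 /andP[t0 t1]; elim: n n0 t t0 t1 => // n IHn _ t t0 t1.
have [nt|tn] := leP n%:R (n.+1%:R * t).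
  by exists n; rewrite ?nt ?ler_piMr.
case: n => [|n] in IHn tn *.
  by move: tn; rewrite ltNge mulr_ge0.
have n1 : 0 < n.+1%:R :> R by [].
(* The point is rescaled so that [n.+1%:R] times it is [n.+2%:R * t]; the cell index given by
   induction then serves for [t]. *)
have [] := IHn isT (n.+2%:R * t / n.+1%:R).
- by rewrite divr_ge0 ?mulr_ge0.
- by rewrite ler_pdivrMr// mul1r ltW.
- move=> k kn; rewrite mulrC divfK ?gt_eqF// => ?; exists k => //.
  exact: ltnW.
Qed.

Lemma interpolation0 (R : realType) n (v : nat -> R) :
  interpolation n v 0 = v 0%N.
Proof.
rewrite /interpolation big1 ?addr0// => i _.
by rewrite clamp_le0 ?mulr0// mulr0 sub0r oppr_le0.
Qed.

Lemma interpolation1 (R : realType) n (v : nat -> R) :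
  interpolation n v 1 = v n.
Proof.
rewrite /interpolation (eq_bigr (fun i : 'I_n => v i.+1 - v i)) => [|i _].
  by rewrite -(big_mkord xpredT (fun i => v i.+1 - v i)) telescope_sumr// addrC subrK.
by rewrite clamp_ge1 ?mulr1// lerBrDr nat1r ler_nat.
Qed.

Lemma interpolation_piecewise_linear (R : realType) n (v : nat -> R) :
  (0 < n)%N -> piecewise_linear 0 1 (interpolation n v).
Proof.
move=> n0; have n0R : 0 < n%:R :> R by rewrite ltr0n.
exists n, (fun i => i%:R / n%:R), v; split => [|||i t iN].
- by rewrite mul0r.
- by rewrite divff ?gt_eqF.
- by move=> i _; rewrite ltr_pM2r ?invr_gt0// ltr_nat.
rewrite ler_pdivrMr// ler_pdivlMr// [t * _]mulrC => it.
rewrite (interpolation_segment _ iN)//; congr (_ + _ * _).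
have -> : i.+1%:R / n%:R - i%:R / n%:R = n%:R^-1 :> R.
  by rewrite -mulrBl -natr1 addrC addKr mul1r.
by rewrite invrK mulrBl divfK ?gt_eqF// mulrC.
Qed.

(** Both [h t] and the right vertex value are within [e] of the left vertex value, and the
    interpolation moves away from the latter by at most the increment over the cell. *)
Lemma interpolation_close (R : realType) (h : R -> R) n (e : R) :
  (0 < n)%N -> (forall s t, s \in `[0, 1] -> t \in `[0, 1] ->
    `|s - t| <= n%:R^-1 -> `|h s - h t| < e) ->
  forall t, t \in `[0, 1] ->
    `|h t - interpolation n (fun i => h (i%:R / n%:R)) t| <= 2 * e.
Proof.
move=> n0 he t t01; have n0R : 0 < n%:R :> R by rewrite ltr0n.
have [|k kn /[dup] kt /andP[kt1 kt2]] := @exists_mesh_cell R n t n0.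
  by move: t01; rewrite in_itv.
rewrite (interpolation_segment _ kn kt).
have k01 (i : nat) : (i <= n)%N -> i%:R / n%:R \in `[(0 : R), 1].
  move=> iN; rewrite in_itv/= divr_ge0// ler_pdivrMr// mul1r ler_nat//.
have tE : t = n%:R * t / n%:R by rewrite mulrC mulKf ?gt_eqF.
have h1 : `|h t - h (k%:R / n%:R)| < e.
  apply: he => //; first by apply: k01; exact: ltnW.
  rewrite {1}tE -mulrBl normrM [`|_^-1|]gtr0_norm ?invr_gt0// ler_piMl ?invr_ge0 ?ler0n//.
  by rewrite ler_norml; rewrite -natr1 in kt2; apply/andP; split; lra.
have h2 : `|h (k.+1%:R / n%:R) - h (k%:R / n%:R)| < e.
  apply: he; [exact: k01|by apply: k01; exact: ltnW|].
  by rewrite -mulrBl -natr1 addrC addKr mul1r ger0_norm ?invr_ge0 ?ler0n.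
set l := _ - k%:R; rewrite opprD addrA; apply: le_trans (ler_normB _ _) _.
have l01 : `|l| <= 1.
  by rewrite ler_norml /l; rewrite -natr1 in kt2; apply/andP; split; lra.
have -> : 2 * e = e + e by ring.
rewrite lerD ?(ltW h1)// normrM; apply: le_trans (ltW h2).
by rewrite ler_piMr.
Qed.

(** * Descent of loops to the circle *)

Lemma S1_hausdorff (R : realType) : hausdorff_space (S1 R).
Proof.
move=> x y clxy; apply: val_inj.
have hRR : hausdorff_space (R * R)%type by exact: norm_hausdorff.
apply: hRR => U V /(initial_continuous (f := val)) Ux /(initial_continuous (f := val)) Vy.
by have [z [Uz Vz]] := clxy _ _ Ux Vy; exists (val z).
Qed.

(** Points of [[0, 1]] at distance below 1 are separated by [covering_map], and only the two
    endpoints are at distance 1. *)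
Lemma covering_map_eq01 (R : realType) (s t : R) :
  s \in `[0, 1] -> t \in `[0, 1] -> covering_map s = covering_map t ->
  [\/ s = t, s = 0 /\ t = 1 | s = 1 /\ t = 0].
Proof.
rewrite !in_itv/= => /andP[s0 s1] /andP[t0 t1] st.
have [lt1|] := ltP `|s - t| 1.
  by constructor 1; exact: covering_map_inj_small.
rewrite ler_normr => /orP[] le1; [constructor 3|constructor 2]; split; lra.
Qed.

(* alpha is a closed map since I is compact and S1 is Hausdorff. *)
Lemma descend_loop (R : realType) (u : R -> S1 R) :
  continuous u -> u 0 = u 1 ->
  exists g : continuousType (S1 R) (S1 R),
    {in `[0, 1], forall t, g (covering_map t) = u t}.
Proof.
move=> cu u01.
have /choice[sec secP] (x : S1 R) : exists t, 0 <= t < 1 /\ covering_map t = x.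
  by have [t] := covering_map_surj x; exists t.
have sec01 x : sec x \in `[0, 1].
  by have [/andP[s0 s1] _] := secP x; rewrite in_itv/= s0 ltW.
(* [sec] can differ from the identity only by exchanging the endpoints, where [u] takes equal
   values. *)
have gE : {in `[0, 1], forall t, u (sec (covering_map t)) = u t}.
  move=> t t01; have [_ E] := secP (covering_map t).
  by have [->|[-> ->]|[-> ->]] := covering_map_eq01 (sec01 _) t01 E.
have cg : continuous (u \o sec).
  apply/continuous_closedP => A clA.
  suff -> : (u \o sec) @^-1` A = @covering_map R @` (`[0, 1] `&` u @^-1` A).
    apply: compact_closed; first exact: S1_hausdorff.
    apply: continuous_compact.
      by apply: continuous_subspaceT; exact: continuous_covering_map.
    apply: compact_closedI; first exact: segment_compact.
    by move/continuous_closedP : cu; exact.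
  apply/seteqP; split => [x /= Ax|_ [t [t01 At] <-]].
    by exists (sec x) => //; have [] := secP x.
  by rewrite /= gE.
pose g : continuousType (S1 R) (S1 R) :=
  HB.pack (u \o sec) (isContinuous.Build _ _ _ cg).
by exists g.
Qed.

(** * The chosen lift and the density theorem *)

Lemma alpha_liftP (R : realType) (f : continuousType (S1 R) (S1 R)) :
  is_lift f (alpha_lift f).
Proof. by apply: xgetPex; apply: lift_exists => x; exact: cts_fun. Qed.

Lemma tilde_unique (R : realType) (q : S1 R) (t : R) :
  0 <= t < 1 -> covering_map t = q -> tilde q = t.
Proof.
move=> t01 tq; apply: xget_unique => // s [/andP[s0 s1] sq].
apply: covering_map_inj_small; first by rewrite sq.
by move: t01 => /andP[t0 t1]; rewrite ltr_norml; apply/andP; split; lra.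
Qed.

(** Uniqueness identifies lifts on [[0, 1]] only, so piecewise linearity has to transfer from
    equality there; monotone breakpoints keep every cell inside [[a, b]]. *)
Lemma eq_piecewise_linear (R : realType) (a b : R) (h k : R -> R) :
  {in `[a, b], h =1 k} -> piecewise_linear a b h -> piecewise_linear a b k.
Proof.
move=> hk [n [s [v [s0 sn s_lt hE]]]]; exists n, s, v; split => // i t iN it.
have s_le (l m : nat) : (l <= m <= n)%N -> s l <= s m.
  elim: m => [|m IHm] /andP[]; first by rewrite leqn0 => /eqP ->.
  rewrite leq_eqVlt => /predU1P[-> //|lm mn].
  by apply: le_trans (IHm _) (ltW (s_lt _ mn)); rewrite -ltnS lm ltnW.
rewrite -hk; first exact: hE.
rewrite in_itv/=; move: it => /andP[it ti].
rewrite -s0 -sn; apply/andP; split.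
- by apply: le_trans it; apply: s_le; rewrite leq0n ltnW.
- by apply: le_trans ti _; apply: s_le; rewrite leqnn andbT.
Qed.

Theorem theorem3p2 (R : realType) (q : S1 R) (m : int) :
  dense_in (@d0 R) (PL_S1 q m) (C_S1 q m).
Proof.
have zero01 : (0 : R) \in `[0, 1] by rewrite in_itv/= lexx ler01.
have one01 : (1 : R) \in `[0, 1] by rewrite in_itv/= lexx ler01.
split=> [f [[_ f0 f1] fq]|f [fq fm] e e0].
  have [_ lf _] := alpha_liftP f; split.
    by rewrite -fq lf// covering_map0.
  by rewrite /winding f0 f1 addrC addKr.
have [cf lf f01] := alpha_liftP f; set h := alpha_lift f in cf lf f01.
have h0q : covering_map (h 0) = q by rewrite lf// covering_map0.
have h1q : covering_map (h 1) = q by rewrite lf// -covering_map01 covering_map0.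
have hm : h 1 = h 0 + m%:~R by rewrite -fm /winding addrC subrK.
have pi8 : 0 < 8 * pi :> R by rewrite mulr_gt0 ?pi_gt0.
(* The interpolation error is at most twice [e / (8 * pi)]; the factor [2 * pi] of [d0] turns this
   into [e / 2]. *)
have [n hn] := filter_ex (segment_unif_mesh cf (divr_gt0 e0 pi8)).
pose v i := h (i%:R / n.+1%:R); pose w := interpolation n.+1 v.
have w0 : w 0 = h 0 by rewrite /w interpolation0 /v mul0r.
have w1 : w 1 = h 1 by rewrite /w interpolation1 /v divff.
have [||g gE] := @descend_loop R (@covering_map R \o w).
- move=> t; apply: continuous_comp; first exact: continuous_interpolation.
  exact: continuous_covering_map.
- by rewrite /= w0 w1 h0q h1q.
have gw : is_lift g w.
  split => [|t t01|]; last by rewrite w0.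
    by apply: continuous_subspaceT; exact: continuous_interpolation.
  by rewrite gE.
have gwE := lift_unique (alpha_liftP g) gw.
exists g.
  have tq : tilde q = h 0 by apply: tilde_unique.
  split; last by rewrite gwE// w0.
  split; [|by rewrite gwE// w0 tq|by rewrite gwE// w1 tq hm].
  apply: (eq_piecewise_linear (h := w)); last exact: interpolation_piecewise_linear.
  by move=> t t01; rewrite gwE.
rewrite /d0; set S := (X in sup X).
suff supS : sup S <= 2 * (e / (8 * pi)).
  have pi2 : 0 < 2 * pi :> R by rewrite mulr_gt0 ?pi_gt0.
  apply: le_lt_trans (ler_wpM2l (ltW pi2) supS) _.
  have := pi_gt0 R; move: pi => p p0.
  have -> : 2 * p * (2 * (e / (8 * p))) = e / 2 by field; rewrite gt_eqF.
  by lra.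
apply: ge_sup.
  (* The supremum bound requires a nonempty set; the point antipodal to the basepoint provides an
     element. *)
  have half0 : covering_map (2^-1 : R) <> basepoint R.
    rewrite -covering_map0 => /covering_map_inj_small; rewrite subr0 gtr0_norm//.
    by rewrite invf_lt1// ltr1n => /(_ isT)/eqP; rewrite invr_eq0 pnatr_eq0.
  by eexists; exists (covering_map 2^-1).
move=> _ [x _ <-]; have x01 : alpha_inv x \in `[0, 1].
  (* The default value 0 of [xget] also lies in [[0, 1]], which settles the other case. *)
  rewrite /alpha_inv; case: xgetP => // t _ [/andP[t0 t1] _].
  by rewrite in_itv/= !ltW.
by rewrite gwE//; exact: interpolation_close.
Qed.
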